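(* For any integers $p\ge 1$ and $a\ge b\ge 1$, \[\mathsf{sep}(C_{2p+2},a,b)=\begin{cases} a-b, & b\le a<2b,\\ a, & a\ge 2b,\end{cases}\] and \[\mathsf{sep}(C_{2p+1},a,b)=\begin{cases} a-b, & b\le a<2b,\\ b+(p+1)(a-2b), & 2b\le a\le 2b+\frac{b}{p},\\ a, & a\ge 2b+\frac{b}{p},\end{cases}\] where $C_m$ denotes the cycle on $m$ vertices.
   Context: All graphs are finite and simple. For integers $a\ge b\ge 1$ and $c\ge 0$: an $a$-list assignment of a graph $G$ is a function $L$ assigning to each vertex $v$ a set $L(v)$ of exactly $a$ integers (colors). It is $c$-separating if $|L(u)\cap L(v)|\le c$ for every edge $uv$. An $(L,b)$-coloring of $G$ is a function $\varphi$ assigning to each vertex $v$ a set $\varphi(v)\subseteq L(v)$ with $|\varphi(v)|=b$ such that $\varphi(u)\cap\varphi(v)=\emptyset$ for every edge $uv$. $G$ is $(a,b,c)$-choosable if for every $c$-separating $a$-list assignment $L$ of $G$ there exists an $(L,b)$-coloring of $G$. The separation number is $\mathsf{sep}(G,a,b)=\max\{c\ge 0 : G \text{ is } (a,b,c)\text{-choosable}\}$.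
   Formalization: The maximum defining sep(G,a,b) is taken over 0 ≤ c ≤ a only, since for c ≥ a every a-list assignment is c-separating and the maximum over all c ≥ 0 does not exist once G is (a,b,a)-choosable. *)

(* Defs.v *)
From mathcomp Require Import all_boot all_order all_algebra.
From mathcomp Require Import finmap.
From mathcomp Require Import boolp.

Set Implicit Arguments.
Unset Strict Implicit.
Unset Printing Implicit Defensive.

Record sgraph := SGraph {
  vertex :> finType;
  adj : rel vertex;
  adj_sym : symmetric adj;
  adj_irr : irreflexive adj }.

Section Choosability.
Variable G : sgraph.
Implicit Types (a b c : nat) (L phi : G -> {fset int}).
Local Open Scope fset_scope.

Definition list_assignment a L : Prop := forall v, #|` L v| = a.

Definition separating c L : Prop :=
  forall u v, adj u v -> #|` L u `&` L v| <= c.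

Definition list_coloring L b phi : Prop :=
  [/\ forall v, phi v `<=` L v,
      forall v, #|` phi v| = b
    & forall u v, adj u v -> phi u `&` phi v = fset0].

Definition choosable a b c : Prop :=
  forall L, list_assignment a L -> separating c L ->
    exists phi, list_coloring L b phi.

(* The maximum is taken over 0 <= c <= a: every a-list assignment is
   a-separating, so (a,b,c)-choosability for c >= a does not depend on c, and
   an uncapped maximum would not exist once G is (a,b,a)-choosable.  For
   b <= a the range contains c = 0, so the maximum is attained (sep_choosable
   below) and the default value 0 of an empty \max plays no role. *)
Definition sep a b : nat := \max_(c < a.+1 | `[< choosable a b c >]) c.

Lemma choosable0 a b : b <= a -> choosable a b 0.
Proof.
move=> ba L La Ls.
have sub v : [fset x in take b (enum_fset (L v))] `<=` L v.
  by apply/fsubsetP => x; rewrite inE => /mem_take.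
exists (fun v => [fset x in take b (enum_fset (L v))]); split=> // [v|u v uv].
  rewrite card_fseq undup_id ?take_uniq ?fset_uniq // size_takel //.
  by rewrite -[size _]/(#|` L v|) La.
apply/eqP; rewrite -fsubset0; apply: (fsubset_trans (fsetISS (sub u) (sub v))).
by rewrite fsubset0 -cardfs_eq0 -leqn0; apply: Ls.
Qed.

Lemma sep_choosable a b : b <= a -> choosable a b (sep a b).
Proof.
move=> ba; have c0 : `[< choosable a b (@ord0 a) >] by apply/asboolP/choosable0.
by rewrite /sep (bigmax_eq_arg ord0 c0); case: arg_maxnP => // c /asboolP.
Qed.

Lemma sep_max a b c : c <= a -> choosable a b c -> c <= sep a b.
Proof.
move=> ca ch; have ca1 : c < a.+1 by [].
by apply: (leq_bigmax_cond (Ordinal ca1)); apply/asboolP.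
Qed.

End Choosability.

(* ordS is the cyclic successor on 'I_m; the conjunct i != j only matters for
   m = 1.  For m >= 3 this is the cycle on m vertices. *)
Definition cycle_adj m : rel 'I_m :=
  fun i j => (i != j) && ((j == ordS i) || (i == ordS j)).

Lemma cycle_adj_sym m : symmetric (@cycle_adj m).
Proof. by move=> i j; rewrite /cycle_adj eq_sym orbC. Qed.

Lemma cycle_adj_irr m : irreflexive (@cycle_adj m).
Proof. by move=> i; rewrite /cycle_adj eqxx. Qed.

Definition cycle_graph m : sgraph :=
  SGraph (@cycle_adj_sym m) (@cycle_adj_irr m).

(* Main.v *)
(** Colouring the cycle v_0, ..., v_n with a >= 2b: fix a b-subset S of L_0, put
    Y_0 = S and Y_i = L_i \ Y_(i-1).  The sets usable at v_i given S are governed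
    by the single constraint |T cap Y_(i-1)| <= sum_(0 < j < i) (|Y_j| - b), so S
    extends to the whole cycle as soon as
      n b + |S cap Y_n| <= sum_(1 <= i <= n) |Y_i|.
    This is a sum of one term per colour x.  For x in L_0, moving x into S costs
    d_x in {0, 1, 2}, the number of odd runs of lists containing x next to v_0
    (1 if all lists contain x).  Choosing S greedily by d_x suffices; on an odd
    cycle one loses 1 for each colour common to all lists, and the separation
    bounds the number of such colours together with sum_x d_x.
    For a < 2b and c = a - b, take phi(v) inside L(v) \ L(v+1).

    Bad lists consist of f colours common to all vertices, c - f colours private
    to each edge and the remaining ones private to a vertex: on m vertices at
    most f floor(m/2) + m (a - c) incidences can be coloured. *)
Require Import Defs.
From mathcomp Require Import all_boot all_order all_algebra.
From mathcomp Require Import finmap boolp zify.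

Set Implicit Arguments.
Unset Strict Implicit.
Unset Printing Implicit Defensive.

Local Open Scope fset_scope.
Local Open Scope nat_scope.

(** * Greedy choices in finite sets and extension of colourings along a path *)

Section FsetCounting.
Variable K : choiceType.
Implicit Types A B S U L Y T : {fset K}.

Lemma fset_between A B k : A `<=` B -> #|` A| <= k <= #|` B| ->
  exists S, [/\ A `<=` S, S `<=` B & #|` S| = k].
Proof.
move=> sAB /andP[Ak kB].
set s := take (k - #|` A|) (enum_fset (B `\` A)).
have ss x : x \in s -> x \in B `\` A by move=> /mem_take.
have us : uniq s by rewrite take_uniq // fset_uniq.
exists (A `|` [fset x in s]); split; first exact: fsubsetUl.
  rewrite fsubUset sAB; apply/fsubsetP => x; rewrite inE => /ss.
  by rewrite inE => /andP[].
have := cardfsUI A [fset x in s].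
have -> : A `&` [fset x in s] = fset0.
  apply/fsetP => x; rewrite !inE; apply/negP => /andP[xA /ss].
  by rewrite inE xA.
rewrite cardfs0 addn0 => ->; rewrite card_fseq undup_id // size_takel.
  by rewrite subnKC.
by rewrite -[size _]/(#|` _|) cardfsDS // leq_sub2r.
Qed.

Lemma sum_fset_mem U A (w : K -> nat) : A `<=` U ->
  \sum_(x <- U) (x \in A) * w x = \sum_(x <- A) w x.
Proof.
move=> /fsubsetP sAU.
transitivity (\sum_(x <- U | x \in A) w x).
  by rewrite [RHS]big_mkcond; apply: eq_bigr => x _; case: ifP; rewrite ?mul1n.
rewrite -big_filter; apply: perm_big; apply: uniq_perm.
- by rewrite filter_uniq ?fset_uniq.
- exact: fset_uniq.
by move=> x; rewrite mem_filter; case: (boolP (x \in A)) => //= /sAU ->.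
Qed.

Lemma card_fset_sum U A : A `<=` U -> #|` A| = \sum_(x <- U) (x \in A).
Proof.
move=> sAU; rewrite -[#|` A|]/(size A) -sum1_size -(sum_fset_mem (fun _ => 1) sAU).
by apply: eq_bigr => x _; rewrite muln1.
Qed.

(** [R] is taken from [L] outside [Y] and [T] as far as possible. Only the shortfall, at most [k] by
    the last hypothesis, can meet [Y]; it fits because [L] minus [T] still has at least [b]
    colours. *)
Lemma avoid_step L Y T b k : 2 * b <= #|` L| -> #|` T| <= b ->
  b + #|` T `&` (L `\` Y)| <= #|` L `\` Y| + k ->
  exists R, [/\ R `<=` L, #|` R| = b, R `&` T = fset0 & #|` R `&` Y| <= k].
Proof.
move=> La Tb Tk; pose A := (L `\` Y) `\` T.
have cA := cardfsID T (L `\` Y); rewrite fsetIC -/A in cA.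
have cLT := cardfsID T L.
have cT : #|` L `&` T| <= #|` T| by rewrite fsubset_leq_card ?fsubsetIr.
have sAL : A `<=` L `\` T by apply/fsetSD/fsubsetDl.
have disjT R : R `<=` L `\` T -> R `<=` L /\ R `&` T = fset0.
  by rewrite fsubsetD -fsetI_eq0 => /andP[? /eqP].
case: (leqP b #|` A|) => bA.
  have [|R [_ sRA Rb]] := @fset_between fset0 A b (fsub0set _).
    by rewrite cardfs0.
  have [RL RT] := disjT R (fsubset_trans sRA sAL).
  exists R; split=> //.
  suff -> : R `&` Y = fset0 by rewrite cardfs0.
  apply/eqP; rewrite fsetI_eq0.
  have : R `<=` L `\` Y by apply: fsubset_trans sRA (fsubsetDl _ _).
  by rewrite fsubsetD => /andP[].
have [|R [sAR sRL Rb]] := @fset_between A (L `\` T) b sAL; first by lia.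
have [RL RT] := disjT R sRL.
exists R; split=> //.
have : R `&` Y `<=` R `\` A.
  apply/fsubsetP => x; rewrite !inE => /andP[-> ->].
  by rewrite !andbF.
move=> /fsubset_leq_card; rewrite cardfsDS //; lia.
Qed.

(* With z, n1, n2 elements of weight 0, 1, 2, the difference of the two sums is
   at least n1 unless S exhausts weight 0 and stops inside weight 1, where it is
   e + z + n2 = 2b + 2e - n1. *)
Lemma greedy_subset L (d : K -> nat) b e :
  (forall x, x \in L -> d x <= 2) -> #|` L| = 2 * b + e ->
  exists S, [/\ S `<=` L, #|` S| = b &
    \sum_(x <- L) (x \in S) * d x
      + minn (\sum_(x <- L) (d x == 1)) (2 * b + 2 * e - \sum_(x <- L) (d x == 1))
    <= \sum_(x <- L) (x \notin S) * d x].
Proof.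
move=> d2 cL.
pose Z := [fset x in L | d x == 0]; pose Q := [fset x in L | d x <= 1].
have sZQ : Z `<=` Q by apply/fsubsetP => x; rewrite !inE => /andP[-> /eqP->].
have sQL : Q `<=` L by apply/fsubsetP => x; rewrite !inE => /andP[].
have sZL := fsubset_trans sZQ sQL.
have sumE (w : K -> nat) : \sum_(x <- L) (w x) * d x =
    \sum_(x <- L) (w x) * (d x == 1) + 2 * \sum_(x <- L) (w x) * (d x == 2).
  rewrite big_distrr /= -big_split /= big_seq [RHS]big_seq.
  by apply: eq_bigr => x /d2; case: (d x) => [|[|[|]]] //= _; lia.
pose z := #|` Z|; pose q := #|` Q|.
have n1E : \sum_(x <- L) (d x == 1) + z = q.
  rewrite /q /z (card_fset_sum sQL) (card_fset_sum sZL) -big_split /=.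
  rewrite big_seq [RHS]big_seq; apply: eq_bigr => x xL; rewrite !inE xL /=.
  by case: (d x) => [|[]].
have n2E : \sum_(x <- L) (d x == 2) + q = 2 * b + e.
  rewrite -cL /q (card_fset_sum sQL) (card_fset_sum (fsubset_refl L)) -big_split.
  rewrite big_seq [RHS]big_seq; apply: eq_bigr => x xL; rewrite !inE xL /=.
  by have := d2 _ xL; case: (d x) => [|[|[]]].
have qL : q <= 2 * b + e by lia.
have sum_nin S (w : K -> nat) : \sum_(x <- L) (x \in S) * w x +
    \sum_(x <- L) (x \notin S) * w x = \sum_(x <- L) w x.
  rewrite -big_split; apply: eq_bigr => x _.
  by case: (x \in S); rewrite /= mul0n mul1n ?addn0.
have n1S := sum_nin _ (fun x => d x == 1 : nat).
have n2S := sum_nin _ (fun x => d x == 2 : nat).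
have cS S : S `<=` L -> #|` S| = \sum_(x <- L) (x \in S) * (d x == 0)
    + \sum_(x <- L) (x \in S) * (d x == 1) + \sum_(x <- L) (x \in S) * (d x == 2).
  move=> sSL; rewrite (card_fset_sum sSL) -!big_split /= big_seq [RHS]big_seq.
  apply: eq_bigr => x xL; have := d2 _ xL; case: (x \in S); last by rewrite !mul0n.
  by case: (d x) => [|[|[]]].
have bound S (P : pred K) :
    (forall x, x \in L -> P x -> x \in S -> False) ->
    \sum_(x <- L) (x \in S) * P x = 0.
  move=> h; rewrite big_seq big1 // => x xL; case: (boolP (P x)) => [Px|_].
    by case: (boolP (x \in S)) => // xS; case: (h x).
  by rewrite muln0.
have fullS S (P : pred K) : (forall x, x \in L -> P x -> x \in S) ->
    \sum_(x <- L) (x \in S) * P x = \sum_(x <- L) P x.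
  move=> h; rewrite big_seq [RHS]big_seq; apply: eq_bigr => x xL.
  by case: (boolP (P x)) => [/(h x xL)->|_]; rewrite ?muln0.
have zE : \sum_(x <- L) (d x == 0) = z.
  rewrite /z (card_fset_sum sZL) big_seq [RHS]big_seq.
  by apply: eq_bigr => x xL; rewrite !inE xL.
(* [S] is filled by increasing weight; the cases say whether it is completed within weight 0, 1 or
   2. *)
case: (leqP b z) => [bz|zb]; last case: (leqP b q) => [bq|qb].
- have [|S [_ sSZ Sb]] := @fset_between fset0 Z b (fsub0set _).
    by rewrite cardfs0.
  exists S; split=> //; first exact: fsubset_trans sSZ sZL.
  have S0 k : 0 < k -> \sum_(x <- L) (x \in S) * (d x == k) = 0.
    move=> k0; apply: bound => x _ /eqP dk /(fsubsetP sSZ).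
    by rewrite !inE dk => /andP[_ /eqP k00]; rewrite k00 in k0.
  have := n1S S; have := n2S S.
  by rewrite !sumE !S0 //; lia.
- have [|S [sZS sSQ Sb]] := @fset_between Z Q b sZQ; first by lia.
  have sSL := fsubset_trans sSQ sQL; exists S; split=> //.
  have S2 : \sum_(x <- L) (x \in S) * (d x == 2) = 0.
    apply: bound => x _ /eqP d2x /(fsubsetP sSQ).
    by rewrite !inE d2x andbF.
  have S0 : \sum_(x <- L) (x \in S) * (d x == 0) = z.
    rewrite fullS // => x xL dx; apply: (fsubsetP sZS).
    by rewrite !inE xL.
  have := n1S S; have := n2S S; have := cS S sSL.
  by rewrite !sumE S0 S2; lia.
- have [|S [sQS sSL Sb]] := @fset_between Q L b sQL; first by lia.
  exists S; split=> //.
  have S0 : \sum_(x <- L) (x \in S) * (d x == 0) = z.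
    rewrite fullS // => x xL dx; apply: (fsubsetP sQS).
    by rewrite !inE xL (eqP dx).
  have S1 : \sum_(x <- L) (x \in S) * (d x == 1) = \sum_(x <- L) (d x == 1).
    rewrite fullS // => x xL dx; apply: (fsubsetP sQS).
    by rewrite !inE xL (eqP dx).
  have := n1S S; have := n2S S; have := cS S sSL.
  by rewrite !sumE S0 S1; lia.
Qed.

Fixpoint alternate (L : nat -> {fset K}) S n :=
  if n is k.+1 then L n `\` alternate L S k else S.

(** Induction from the far end: [T] is prescribed at vertex [n.+1], [avoid_step] picks a set [R] at
    vertex [n] disjoint from [T], and [R] then plays the role of [T] on the shorter path. *)
Lemma path_coloring (L : nat -> {fset K}) S b n T :
  #|` S| = b ->
  (forall i, 0 < i <= n -> 2 * b <= #|` L i|) ->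
  #|` T| = b ->
  n * b + #|` T `&` alternate L S n|
    <= \sum_(1 <= i < n.+1) #|` alternate L S i| ->
  exists phi : nat -> {fset K}, [/\ phi 0 = S, phi n.+1 = T,
    forall i, 0 < i <= n -> phi i `<=` L i /\ #|` phi i| = b
    & forall i, i <= n -> phi i `&` phi i.+1 = fset0].
Proof.
move=> Sb; elim: n T => [|n IH] T Ln Tb.
  rewrite big_geq // leqn0 cardfs_eq0 /= => /eqP TS.
  exists (fun i => if i == 0 then S else T).
  by split=> // [[]|[]] //= _; rewrite fsetIC.
(* Two consecutive terms add up to at least the size of the later list, hence to at least [2 * b].
   The surplus passed to [avoid_step] below is therefore an exact subtraction. *)
have Kn k : k <= n -> k * b <= \sum_(1 <= i < k.+1) #|` alternate L S i|.
  elim/ltn_ind: k => [[|[|j]]] // IHj jn; rewrite big_nat_recr //=.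
    rewrite big_geq // mul1n add0n.
    have := cardfsD (L 1) S; have := Ln 1 isT.
    have : #|` L 1 `&` S| <= #|` S| by rewrite fsubset_leq_card ?fsubsetIr.
    by lia.
  rewrite big_nat_recr //=; have := IHj j (leqnSn _) (leq_trans (leqW (leqW (leqnn j))) jn).
  set X := L j.+1 `\` _.
  have := cardfsID X (L j.+2).
  have : #|` L j.+2 `&` X| <= #|` X| by rewrite fsubset_leq_card ?fsubsetIr.
  have : 2 * b <= #|` L j.+2| by apply: Ln; rewrite /= leqW.
  lia.
rewrite big_nat_recr //= => TK.
have Knn := Kn n (leqnn n).
have [||R [RL Rb RT RY]] := @avoid_step (L n.+1) (alternate L S n) T b
  (\sum_(1 <= i < n.+1) #|` alternate L S i| - n * b) (Ln n.+1 (leqnn _)).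
- by rewrite Tb.
- by lia.
have [|||phi [p0 pn pL pd]] := IH R.
- by move=> i /andP[i0 ni]; apply: Ln; rewrite i0 leqW.
- by [].
- by lia.
exists (fun i => if i <= n.+1 then phi i else T).
split=> //; first by rewrite ltnn.
  move=> i /andP[i0 ni]; rewrite ni.
  case: (ltngtP i n.+1) ni => // [ni _|-> _]; first by apply: pL; rewrite i0.
  by rewrite pn.
move=> i ni; rewrite ni; case: (ltngtP i n.+1) ni => // [ni _|-> _].
  exact: pd.
by rewrite pn.
Qed.
End FsetCounting.

(** * The alternation followed by a single colour along the path *)

Section Alternation.
Variable l : nat -> bool.

(** Trace of one fixed colour in [alternate]: [l i] says whether it belongs to the list at [i], and
    [s] whether it belongs to [S]. *)
Fixpoint alt s n := if n is k.+1 then l n && ~~ alt s k else s.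

Definition alt_sum s n := \sum_(1 <= i < n.+1) alt s i.

(* The loss caused by starting the alternation with [true], where ending with
   [true] costs one more.  The subtraction never truncates. *)
Definition arm n := alt_sum false n + alt true n - alt_sum true n.

Lemma alt_sumS s n : alt_sum s n.+1 = alt_sum s n + alt s n.+1.
Proof. by rewrite /alt_sum big_nat_recr. Qed.

(* As long as l is constantly true the two alternations are complementary; they
   merge at the first false value and stay equal afterwards. *)
Lemma alt_invariant n :
  let A := alt_sum false n in let B := alt_sum true n in
  let N := \sum_(1 <= i < n.+1) l i in
  if all l (iota 1 n) then
    [/\ alt false n = odd n, alt true n = ~~ odd n, A + B = n, N = n
      & A = B + odd n]
  else [/\ alt false n = alt true n, N + alt true n <= A + B, B <= A
      & A <= B + l 1].
Proof.
elim: n => [|n]; first by rewrite /alt_sum /= !big_geq.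
have -> : all l (iota 1 n.+1) = all l (iota 1 n) && l n.+1.
  by rewrite -(addn1 n) iotaD all_cat /= andbT add1n addn1.
have odd_l1 : all l (iota 1 n) -> odd n <= l 1.
  by case: (n) => //= k /andP[->]; case: odd.
rewrite !alt_sumS [\sum_(_ <= _ < n.+2) _]big_nat_recr //=.
move: (alt_sum _ n) (alt_sum _ n) (\sum_(_ <= _ < _) _) => A B N.
case: (all l (iota 1 n)) odd_l1 => /= [/(_ isT) + [-> ->]|_ [-> + + +]].
  by case: (l n.+1); case: (odd n) => /= *; split; lia.
by case: (l n.+1); case: (alt true n) => /= *; split; lia.
Qed.

Lemma arm_le n : 0 < n -> arm n <= l 1 + l n.
Proof.
move=> n0; have := alt_invariant n; rewrite /arm /=.
case: ifP => [/allP ln [_ -> _ _ ->]|_ [_ _ BA AB]].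
  have -> : l 1 by apply: ln; rewrite mem_iota /=; lia.
  have -> : l n by apply: ln; rewrite mem_iota /=; lia.
  by case: odd; lia.
have : alt true n <= l n by case: (n) n0 => //= k _; case: (l _) => //=; case: alt.
lia.
Qed.

Lemma arm_full n : all l (iota 1 n) -> arm n = 1.
Proof.
move=> ln; have := alt_invariant n; rewrite /arm /= ln => -[_ -> _ _ ->].
by case: odd; lia.
Qed.

Lemma alt_sum_ge n : \sum_(1 <= i < n.+1) l i <= 2 * alt_sum false n.
Proof. by have := alt_invariant n => /=; case: ifP => _ []; lia. Qed.

(** In the notation of [alt_invariant], both values of [s] amount to N + [alt true n] <= A + B. This
    fails, and then by 1, only when [l] is true throughout and [n] is even. *)
Lemma alt_sum_arm n s : 0 < n ->
  \sum_(1 <= i < n.+1) l i + ~~ s * arm n + 2 * (s && alt s n)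
    <= 2 * alt_sum s n + s * arm n + (all l (iota 1 n) && ~~ odd n).
Proof.
move=> n0; have := alt_invariant n; rewrite /arm /=.
case: ifP => _ [_ +].
  by move=> tn ABn -> AB; case: s; rewrite /= tn; case: odd ABn AB => /=; lia.
by case: s => /=; case: (alt true n) => /=; lia.
Qed.
End Alternation.

(** * Closing the path into a cycle *)

Section CycleColoring.
Variable K : choiceType.
Implicit Types S : {fset K}.

Lemma in_alternate (L : nat -> {fset K}) S n x :
  (x \in alternate L S n) = alt (fun i => x \in L i) (x \in S) n.
Proof. by elim: n => //= n IH; rewrite inE IH andbC. Qed.

(** Index [n.+1] stands for vertex 0 again, so the cycle has [n.+1] vertices and is even when [n] is
    odd. [path_coloring] is applied with [T] equal to [S]. *)
Lemma cycle_coloring (L : nat -> {fset K}) n a b c :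
  0 < n -> 2 * b <= a ->
  (forall i, i <= n -> #|` L i| = a) ->
  #|` L 0 `&` L 1| <= c -> #|` L 0 `&` L n| <= c ->
  (odd n \/ 2 * c <= 2 * b + n.+2 * (a - 2 * b)) ->
  exists phi : nat -> {fset K}, [/\ phi 0 = phi n.+1,
    forall i, i <= n -> phi i `<=` L i /\ #|` phi i| = b
    & forall i, i <= n -> phi i `&` phi i.+1 = fset0].
Proof.
move=> n0 ba La c1 cn hc.
pose l x i := x \in L i; pose d x := arm (l x) n.
have aE : #|` L 0| = 2 * b + (a - 2 * b) by rewrite La //; lia.
have d2 x : d x <= 2.
  by apply: leq_trans (arm_le _ n0) _; case: (l x 1); case: (l x n).
have [S [SL Sb]] := greedy_subset (fun x _ => d2 x) aE.
set n1 := \sum_(_ <- _) (_ == _ : nat) => gS.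
have [|||phi [p0 pn pL pd]] := @path_coloring _ L S b n S Sb.
- by move=> i /andP[_ ni]; rewrite La.
- by [].
- pose U := \bigcup_(i <- iota 0 n.+1) L i.
  have LU i : i <= n -> L i `<=` U.
    by move=> ni; apply: (bigfcup_sup L) => //; rewrite mem_iota.
  pose full x := all (l x) (iota 1 n).
  (* Share of the colour [x] in twice the required inequality; the terms in [d x] are those balanced
     by [greedy_subset]. *)
  have pw x : \sum_(1 <= i < n.+1) (x \in L i)
      + (x \in L 0) * ((x \notin S) * d x)
      + 2 * (x \in S `&` alternate L S n)
    <= 2 * (\sum_(1 <= i < n.+1) (x \in alternate L S i))
      + (x \in L 0) * ((x \in S) * d x) + (x \in L 0) * (full x && ~~ odd n).
    have -> : \sum_(1 <= i < n.+1) (x \in alternate L S i) =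
        alt_sum (l x) (x \in S) n.
      by apply: eq_bigr => i _; rewrite in_alternate.
    rewrite inE in_alternate; case: (boolP (x \in L 0)) => [xL|xL].
      by rewrite !mul1n; apply: alt_sum_arm.
    have /negPf -> : x \notin S by apply: contra xL => /(fsubsetP SL).
    by rewrite !mul0n !muln0 !addn0; apply: alt_sum_ge.
  have sum_card (F : nat -> {fset K}) : (forall i, 0 < i <= n -> F i `<=` U) ->
      \sum_(x <- U) \sum_(1 <= i < n.+1) (x \in F i)
      = \sum_(1 <= i < n.+1) #|` F i|.
    move=> FU; rewrite exchange_big big_nat [RHS]big_nat /=.
    by apply: eq_bigr => i iP; rewrite (card_fset_sum (FU i iP)).
  have YU i : 0 < i <= n -> alternate L S i `<=` U.
    by case: i => // i /andP[_ /LU]; apply/fsubset_trans/fsubsetDl.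
  have SYU : S `&` alternate L S n `<=` U.
    by apply: fsubset_trans (fsubset_trans (fsubsetIl _ _) SL) (LU 0 _).
  have sumL : \sum_(x <- U) \sum_(1 <= i < n.+1) (x \in L i) = n * a.
    rewrite sum_card => [|i /andP[_ /LU] //].
    rewrite big_nat (eq_bigr (fun _ => a)); last by move=> i /andP[_ /La].
    by rewrite -big_nat sum_nat_const_nat subn1.
  have := @leq_sum _ U xpredT _ _ (fun x _ => pw x); rewrite !big_split /= !big1_eq.
  rewrite sumL (sum_card _ YU) -(card_fset_sum SYU) !(sum_fset_mem _ (LU 0 _)) //.
  set f := \sum_(_ <- L 0) (full _ && _ : nat) => main.
  have f_n1 : f <= n1.
    apply: leq_sum => x _; case: (boolP (full x)) => //= /arm_full.
    by rewrite /d => ->; case: odd.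
  have n1a : n1 <= a.
    rewrite -(La 0) // (card_fset_sum (fsubset_refl _)) /n1.
    rewrite big_seq [leqRHS]big_seq.
    by apply: leq_sum => x ->; apply: leq_b1.
  (* A colour common to all lists counts at most twice and lies in both intersections; any other
     colour counts at most [d x], which [arm_le] bounds by its memberships in [L 1] and [L n]. *)
  have n1_2c : n1 + f <= 2 * c.
    have : n1 + f <= #|` L 0 `&` L 1| + #|` L 0 `&` L n|.
      rewrite !(card_fset_sum (fsubsetIl _ _)) -!big_split /= big_seq [leqRHS]big_seq.
      apply: leq_sum => x xL; rewrite !inE xL /=.
      case: (boolP (full x)) => /= [|_].
        move=> fx; rewrite /d arm_full //.
        have lx i : 0 < i <= n -> x \in L i.
          by move=> iP; apply: (allP fx); rewrite mem_iota add1n ltnS.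
        by rewrite !lx ?n0 ?leqnn //; case: odd.
      apply: leq_trans (arm_le (l x) n0).
      by rewrite addn0 -/(d x); case: (d x) => [|[]].
    lia.
  have f0 : odd n -> f = 0.
    by move=> on; apply: big1 => x _; rewrite on andbF.
  have naE : n * a = 2 * (n * b) + n * (a - 2 * b).
    by rewrite mulnCA -mulnDr; congr (_ * _); lia.
  (* The loss [f] must be covered by [n * (a - 2 * b)] plus the [minn] of [greedy_subset]: [f_n1]
     handles its first argument, this bound the second. *)
  have hf : f = 0 \/ n1 + f <= 2 * b + (n * (a - 2 * b) + 2 * (a - 2 * b)).
    case: hc => [/f0|hc]; [by left|right].
    by rewrite -mulnDl addn2; apply: leq_trans hc.
  move: main gS hf f_n1 n1a; rewrite naE; clearbody f n1.
  set M := \sum_(_ <= _ < _) _; set s1 := \sum_(_ <- _) _ * _.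
  set s2 := \sum_(_ <- _) _ * _; set y := #|` _|.
  by move: (n * b) (n * (a - 2 * b)) => nb ne; clear -ba; lia.
exists phi; split=> //; first by rewrite p0 pn.
by move=> [|i] ni; [rewrite p0|apply: pL].
Qed.
End CycleColoring.

(** * Monotonicity in the separation and evaluation of [sep] *)

Lemma choosable_leq (G : sgraph) a b c c' :
  c <= c' -> choosable G a b c' -> choosable G a b c.
Proof.
by move=> cc ch L La Ls; apply: ch => // u v /Ls /leq_trans; apply.
Qed.

Lemma sep_eq (G : sgraph) a b c : b <= a -> c <= a ->
  choosable G a b c -> (c < a -> ~ choosable G a b c.+1) -> sep G a b = c.
Proof.
move=> ba ca ch nch; apply/eqP; rewrite eqn_leq sep_max // andbT leqNgt.
apply/negP => cs.
have sa : sep G a b <= a.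
  by apply/bigmax_leqP => i _; rewrite -ltnS.
apply: (nch (leq_trans cs sa)).
exact: (choosable_leq cs (sep_choosable ba)).
Qed.

(** * Choosability of cycles with at least three vertices *)

Section Cycle.
Variable n : nat.
Local Notation m := n.+3.

Lemma ordS_neq (v : 'I_m) : v != ordS v.
Proof.
apply/eqP => /(congr1 val) /=; have := ltn_ord v; rewrite leq_eqVlt.
by case/orP => [/eqP[->]|vn]; [rewrite modnn|rewrite modn_small; lia].
Qed.

Lemma adj_ordS (v : 'I_m) : @adj (cycle_graph m) v (ordS v).
Proof. by rewrite /= /cycle_adj ordS_neq eqxx. Qed.

Lemma cycle_choosable_sub a b : b <= a -> choosable (cycle_graph m) a b (a - b).
Proof.
move=> ba L La Ls.
have /choice[phi phiP] (v : cycle_graph m) : exists S : {fset int},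
    S `<=` L v `\` L (ordS v) /\ #|` S| = b.
  have [|S [_ ? ?]] := @fset_between _ fset0 (L v `\` L (ordS v)) b (fsub0set _).
    rewrite cardfs0 cardfsD La leq_subCr //; first exact/Ls/adj_ordS.
    by rewrite -[leqRHS](La v) fsubset_leq_card ?fsubsetIl.
  by exists S.
have disj v : phi v `&` phi (ordS v) = fset0.
  have [sv _] := phiP v; have [sw _] := phiP (ordS v).
  apply/fsetP => x; rewrite !inE; apply/negP => /andP[/(fsubsetP sv) + /(fsubsetP sw)].
  by rewrite !inE => /andP[/negP nx _] /andP[_].
exists phi; split=> [v|v|u v].
- by have [/fsubset_trans-> //] := phiP v; apply: fsubsetDl.
- by have [] := phiP v.
- by case/andP => _ /orP[/eqP->|/eqP->]; [|rewrite fsetIC].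
Qed.

Lemma cycle_choosable a b c : 2 * b <= a ->
  (~~ odd m \/ 2 * c <= 2 * b + m.+1 * (a - 2 * b)) ->
  choosable (cycle_graph m) a b c.
Proof.
move=> ba hc L La Ls.
pose Ls' i := L (inord i : 'I_m).
have i0 : inord 0 = ord0 :> 'I_m by apply: val_inj; rewrite /= inordK.
have o1 : ordS ord0 = inord 1 :> 'I_m by apply: val_inj; rewrite /= inordK.
have om : ordS (inord n.+2) = ord0 :> 'I_m.
  by apply: val_inj; rewrite /= inordK // modnn.
have [||||||phi [p0 pL pd]] := @cycle_coloring _ Ls' n.+2 a b c.
- by [].
- by [].
- by move=> i _; apply: La.
- by rewrite /Ls' i0 -o1; apply/Ls/adj_ordS.
- by rewrite /Ls' i0 -om fsetIC; apply/Ls/adj_ordS.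
- by move: hc; rewrite /= negbK.
have disj (v : 'I_m) : phi v `&` phi (ordS v) = fset0.
  have := ltn_ord v; rewrite ltnS leq_eqVlt => /orP[/eqP vn|vn].
    by rewrite /= vn modnn p0; apply: pd.
  by rewrite /= modn_small ?ltnS //; apply: pd; apply: ltnW.
exists (fun v : 'I_m => phi v); split=> [v|v|u v].
- by have [] := pL v (leq_ord v); rewrite /Ls' inord_val.
- by have [] := pL v (leq_ord v).
- by case/andP => _ /orP[/eqP->|/eqP->]; [|rewrite fsetIC].
Qed.

(** Distinct [v] thus give distinct edges from [v] to [ordS v], so a colour private to one edge is
    not shared along another. *)
Lemma ordSS_neq (v : 'I_m) : ordS (ordS v) != v.
Proof.
apply/eqP => /(congr1 val) /=; have := ltn_ord v; rewrite leq_eqVlt.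
case/orP => [/eqP[->]|]; first by rewrite modnn modn_small.
rewrite leq_eqVlt => /orP[/eqP[vn]|vn]; last by rewrite !modn_small; lia.
by rewrite vn (@modn_small n.+2) // modnn; move: vn; case: (val v).
Qed.

Lemma sum_eq_ord k (w : 'I_k) : \sum_(v < k) (v == w) = 1.
Proof. by rewrite (bigD1 w) //= eqxx big1 // => i /negPf->. Qed.

Lemma sum_eq_ordS (w : 'I_m) : \sum_(v < m) (ordS v == w) = 1.
Proof.
rewrite -[RHS](sum_eq_ord (ord_pred w)); apply: eq_bigr => v _.
by rewrite (can2_eq (@ordSK _) (@ord_predK _)).
Qed.

(** Summing the hypothesis over all [v] counts every vertex twice, which bounds an independent set
    of the cycle. *)
Lemma sum_independent (u : 'I_m -> bool) :
  (forall v, u v + u (ordS v) <= 1) -> \sum_v u v <= m./2.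
Proof.
move=> u1; rewrite geq_half_double -addnn.
rewrite {2}(reindex_inj (@ordS_inj _)) -big_split /=.
by apply: leq_trans (leq_sum _ (fun v _ => u1 v)) _; rewrite sum1_card card_ord.
Qed.

Lemma sum_independent_edge (u : 'I_m -> bool) w :
  (forall v, u v + u (ordS v) <= 1) ->
  (forall v, u v -> (v == w) || (v == ordS w)) -> \sum_v u v <= 1.
Proof.
move=> u1 uw; apply: leq_trans (u1 w).
have -> : u w + u (ordS w) =
    \sum_(v < m) ((v == w) * u w + (v == ordS w) * u (ordS w)).
  by rewrite big_split -!big_distrl /= !sum_eq_ord !mul1n.
apply: leq_sum => v _; case: (boolP (u v)) => // uv.
by move: (uv); case/orP: (uw v uv) => /eqP-> ->; rewrite eqxx; lia.
Qed.

(** * Separating lists that admit no colouring *)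

Section BadLists.
Variables a c f : nat.
Hypotheses (fc : f <= c) (ca : 2 * c <= a + f).

(* A pair (w, j) in the second summand belongs to the edge from w to ordS w. *)
Definition color : finType :=
  ('I_f + 'I_m * 'I_(c - f) + 'I_m * 'I_(a + f - 2 * c))%type.

Definition allowed (v : 'I_m) (t : color) : bool :=
  match t with
  | inl (inl _) => true
  | inl (inr (w, _)) => (v == w) || (v == ordS w)
  | inr (w, _) => v == w
  end.

(** Lists consist of integers, so the finite type of colours is embedded through its countable
    encoding. *)
Definition encode (t : color) : int := Posz (choice.pickle t).

Definition bad_lists (v : 'I_m) : {fset int} :=
  [fset x in [seq encode t | t <- enum (allowed v)]].

Lemma encode_inj : injective encode.
Proof. by move=> s t [] /(pcan_inj choice.pickleK). Qed.

Lemma mem_bad_lists v t : (encode t \in bad_lists v) = allowed v t.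
Proof. by rewrite inE (mem_map encode_inj) mem_enum. Qed.

Lemma sum_color (F : color -> nat) :
  \sum_t F t = \sum_i F (inl (inl i)) + \sum_w \sum_j F (inl (inr (w, j)))
    + \sum_w \sum_j F (inr (w, j)).
Proof.
rewrite !big_sumType /= !pair_bigA /=.
by congr (_ + _ + _); apply: eq_bigr => -[].
Qed.

Lemma card_bad_sub v (A : {fset int}) : A `<=` bad_lists v ->
  #|` A| = \sum_(t : color) (encode t \in A).
Proof.
move=> /fsubsetP sA.
transitivity (size [seq encode t | t <- index_enum color & encode t \in A]).
  apply: perm_size; apply: uniq_perm; rewrite ?fset_uniq //.
    by rewrite map_inj_uniq ?filter_uniq ?index_enum_uniq //; apply: encode_inj.
  move=> x; apply/idP/mapP => [xA|[t]]; last by rewrite mem_filter => /andP[? _] ->.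
  have := sA x xA; rewrite inE => /mapP[t _ xt]; exists t => //.
  by rewrite mem_filter -xt xA mem_index_enum.
by rewrite size_map size_filter -sum1_count big_mkcond.
Qed.

(** Each vertex lies on two edges, so its list has f + 2 (c - f) + (a + f - 2 c) = a colours. *)
Lemma bad_lists_assignment : @list_assignment (cycle_graph m) a bad_lists.
Proof.
move=> v; rewrite (card_bad_sub (fsubset_refl (bad_lists v))).
under eq_bigr do rewrite mem_bad_lists.
rewrite sum_color /= sum1_card card_ord.
under eq_bigr do rewrite sum_nat_const card_ord.
under [X in _ + X]eq_bigr do rewrite sum_nat_const card_ord.
rewrite -!big_distrr /=.
have eqv : \sum_(w < m) (v == w) = 1.
  by under eq_bigr do rewrite eq_sym; apply: sum_eq_ord.
have -> : \sum_(w < m) ((v == w) || (v == ordS w)) = 2.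
  transitivity (\sum_(w < m) ((v == w) + (ordS w == v))).
    apply: eq_bigr => w _; rewrite (eq_sym _ v).
    by case: eqP => [<-|//]; rewrite (negPf (ordS_neq v)).
  by rewrite big_split /= eqv sum_eq_ordS.
by rewrite eqv; lia.
Qed.

Lemma bad_lists_separating : @separating (cycle_graph m) c bad_lists.
Proof.
have sepS (v : 'I_m) : #|` bad_lists v `&` bad_lists (ordS v)| <= c.
  rewrite (card_bad_sub (fsubsetIl _ _)).
  under eq_bigr do rewrite inE !mem_bad_lists.
  rewrite sum_color /= sum1_card card_ord.
  have -> : \sum_(w < m) \sum_(j < a + f - 2 * c) ((v == w) && (ordS v == w)) = 0.
    apply: big1 => w _; apply: big1 => j _.
    by case: eqP => // <-; rewrite eq_sym (negPf (ordS_neq v)).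
  under eq_bigr do rewrite sum_nat_const card_ord.
  rewrite -big_distrr /= addn0 -leq_subRL // -[leqRHS]muln1 leq_mul2l.
  apply/orP; right; rewrite -(sum_eq_ord v); apply: leq_sum => w _.
  rewrite (inj_eq (@ordS_inj _)) (eq_sym v w).
  case: (eqVneq w v) => [_|nwv] /=; first exact: leq_b1.
  by case: eqP => // ->; rewrite orbF (negPf (ordSS_neq w)).
move=> u v /andP[_ /orP[/eqP->|/eqP->]]; first exact: sepS.
by rewrite fsetIC; apply: sepS.
Qed.

(** Double counting of the pairs of a vertex and a colour used there; the hypothesis is f floor(m/2)
    + m (a - c) < m b without subtraction. *)
Lemma bad_lists_not_colorable b phi :
  f * m./2 + m * a < m * (b + c) ->
  ~ @list_coloring (cycle_graph m) bad_lists b phi.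
Proof.
move=> big [phiL phib phid].
have := leqnn (m * b).
have {2}-> : m * b = \sum_(t : color) \sum_(v < m) (encode t \in phi v).
  rewrite exchange_big -[m in LHS]card_ord -sum_nat_const.
  by apply: eq_bigr => v _; rewrite -(card_bad_sub (phiL v)) phib.
have ind t (v : 'I_m) : (encode t \in phi v) + (encode t \in phi (ordS v)) <= 1.
  have /fsetP/(_ (encode t)) := phid _ _ (adj_ordS v).
  by rewrite !inE; case: (_ \in _); case: (_ \in _).
have use t (v : 'I_m) : encode t \in phi v -> allowed v t.
  by move=> /(fsubsetP (phiL v)); rewrite mem_bad_lists.
rewrite sum_color.
have h1 : \sum_(i < f) \sum_(v < m) (encode (inl (inl i)) \in phi v) <= f * m./2.
  rewrite -[f in leqRHS]card_ord -sum_nat_const; apply: leq_sum => i _.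
  exact: sum_independent (ind _).
have h2 : \sum_(w < m) \sum_(j < c - f) \sum_(v < m)
    (encode (inl (inr (w, j))) \in phi v) <= m * (c - f).
  rewrite -[m in leqRHS]card_ord -sum_nat_const; apply: leq_sum => w _.
  rewrite -[c - f in leqRHS]card_ord -[leqRHS]muln1 -sum_nat_const.
  apply: leq_sum => j _; apply: sum_independent_edge (ind _) _ => v.
  exact: use.
have h3 : \sum_(w < m) \sum_(j < a + f - 2 * c) \sum_(v < m)
    (encode (inr (w, j)) \in phi v) <= m * (a + f - 2 * c).
  rewrite -[m in leqRHS]card_ord -sum_nat_const; apply: leq_sum => w _.
  rewrite -[a + f - 2 * c in leqRHS]card_ord -[leqRHS]muln1 -sum_nat_const.
  apply: leq_sum => j _; apply: (@sum_independent_edge _ w (ind _)) => v.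
  by move=> /use /= ->.
move=> /leq_trans/(_ (leq_add (leq_add h1 h2) h3)) tot.
have mE : m * (c - f) + m * (a + f - 2 * c) + m * c = m * a.
  by rewrite -!mulnDr; congr (_ * _); lia.
move: big tot; rewrite mulnDr -mE; clear; lia.
Qed.
End BadLists.

Lemma cycle_not_choosable a b c f : f <= c -> 2 * c <= a + f ->
  f * m./2 + m * a < m * (b + c) -> ~ choosable (cycle_graph m) a b c.
Proof.
move=> fc ca big ch.
have [||phi] := ch (bad_lists a c f); last exact: bad_lists_not_colorable.
  exact: bad_lists_assignment.
exact: bad_lists_separating.
Qed.
End Cycle.

(** * Separation numbers of even and odd cycles *)

Theorem theorem1 (p a b : nat) (hp : 1 <= p) (hb : 1 <= b) (hab : b <= a) :
  ((b <= a < 2 * b -> sep (cycle_graph (2 * p + 2)) a b = a - b) /\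
   (2 * b <= a -> sep (cycle_graph (2 * p + 2)) a b = a))
  /\
  [/\ (b <= a < 2 * b -> sep (cycle_graph (2 * p + 1)) a b = a - b),
      (2 * b <= a -> (a%:R <= 2 * b%:R + b%:R / p%:R :> rat)%R ->
         sep (cycle_graph (2 * p + 1)) a b = b + (p + 1) * (a - 2 * b))
    & ((2 * b%:R + b%:R / p%:R <= a%:R :> rat)%R ->
         sep (cycle_graph (2 * p + 1)) a b = a)].
Proof.
have sep_small n : a < 2 * b -> sep (cycle_graph n.+3) a b = a - b.
  move=> ab; apply: sep_eq; rewrite ?leq_subr //.
    exact: cycle_choosable_sub.
  (* For c = a - b + 1, one common colour suffices for 2 c <= a + f, even at a = 2 b - 1; what
     remains is floor(m/2) < m. *)
  move=> _; apply: (@cycle_not_choosable _ _ _ _ 1); rewrite ?addnS //; first by lia.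
  by rewrite subnKC // mulnS mul1n ltn_add2r; lia.
have p0 : (0 < p%:R :> rat)%R by rewrite Num.Theory.ltr0n.
(* The truncated subtraction is harmless: for a < 2 b both sides hold. *)
have le1 : (a%:R <= 2 * b%:R + b%:R / p%:R :> rat)%R = (p * (a - 2 * b) <= b).
  rewrite -(Num.Theory.ler_pM2r p0) GRing.mulrDl GRing.divfK ?Order.POrderTheory.gt_eqF //.
  rewrite -!GRing.natrM -GRing.natrD Num.Theory.ler_nat mulnBr leq_subLR.
  by rewrite mulnC (mulnC p (2 * b)).
have le2 : (2 * b%:R + b%:R / p%:R <= a%:R :> rat)%R =
   (2 * b <= a) && (b <= p * (a - 2 * b)).
  rewrite -(Num.Theory.ler_pM2r p0) GRing.mulrDl GRing.divfK ?Order.POrderTheory.gt_eqF //.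
  rewrite -!GRing.natrM -GRing.natrD Num.Theory.ler_nat.
  case: (leqP (2 * b) a) => /= ba.
    by rewrite -{1}(subnKC ba) mulnDl leq_add2l mulnC.
  have : a * p <= 2 * b * p by rewrite leq_mul2r ltnW ?orbT.
  lia.
rewrite le1 le2.
case: p hp {p0 le1 le2} => // q _.
have -> : 2 * q.+1 + 2 = (2 * q).+1.+3 by lia.
have -> : 2 * q.+1 + 1 = (2 * q).+3 by lia.
(* With m = 2 p + 1 and p = q + 1, the factor m + 1 in [cycle_choosable] is 2 (p + 1), so its bound
   on 2 c can be halved. *)
have odd_ch c : 2 * b <= a -> c <= b + (q.+1 + 1) * (a - 2 * b) ->
    choosable (cycle_graph (2 * q).+3) a b c.
  move=> ba cb; apply: cycle_choosable => //; right.
  have -> : (2 * q).+4 = 2 * (q.+1 + 1) by lia.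
  by rewrite -mulnA -mulnDr leq_mul2l.
split; split.
- by case/andP => _; apply: sep_small.
- move=> ba; apply: sep_eq => //; last by rewrite ltnn.
  by apply: cycle_choosable => //; left; rewrite /= mul2n odd_double.
- by case/andP => _; apply: sep_small.
- move=> ba pe.
  have cE : b + (q.+1 + 1) * (a - 2 * b) = b + (q.+1 * (a - 2 * b) + (a - 2 * b)).
    by rewrite mulnDl mul1n.
  apply: sep_eq => //; first by rewrite cE; lia.
    exact: odd_ch.
  rewrite cE => ca.
  set e := a - 2 * b in cE ca pe *.
  (* For the separation c = b + (p+1) e + 1, this is f = 2 c - a = (2p+1) e + 2,
     which leaves no colour private to a vertex. *)
  apply: (@cycle_not_choosable _ _ _ _ (2 * (q.+1 * e) + e + 2)).
  - lia.
  - lia.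
  (* With f = m e + 2 and b + c = a + p e + 1, the inequality reduces to 2 p < m. *)
  - have -> : 2 * (q.+1 * e) + e + 2 = (2 * q).+3 * e + 2 by lia.
    have -> : b + (b + (q.+1 * e + e)).+1 = a + q.+1 * e + 1 by lia.
    have -> : (2 * q).+3./2 = q.+1 by lia.
    by rewrite mulnDl -mulnA (mulnC e) !mulnDr muln1; lia.
(* Here b <= p (a - 2 b) means a <= b + (p + 1) (a - 2 b), so [odd_ch] reaches c = a. *)
- case/andP => ba pe; apply: sep_eq => //; last by rewrite ltnn.
  by apply: odd_ch => //; rewrite mulnDl mul1n; lia.
Qed.
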